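(* Let $\mathcal{L}=\{H_i\}_{i\in I}$ and $\mathcal{E}=\{E_j\}_{j\in J}$ be partitions of $\Omega$ ($I,J$ arbitrary), let $\mathcal{A}_{\mathcal L},\mathcal{A}_{\mathcal E},\mathcal{A}$ be Boolean algebras with $\langle\mathcal L\rangle\subseteq\mathcal A_{\mathcal L}\subseteq\langle\mathcal L\rangle^*$, $\langle\mathcal E\rangle\subseteq\mathcal A_{\mathcal E}\subseteq\langle\mathcal E\rangle^*$, $\langle\mathcal A_{\mathcal L}\cup\mathcal A_{\mathcal E}\rangle\subseteq\mathcal A\subseteq\langle\mathcal A_{\mathcal L}\cup\mathcal A_{\mathcal E}\rangle^*$. Let $\sigma$ be a strategy on $\mathcal A\times\mathcal L$ such that $\sigma(F|\cdot)$ is $\mathcal A_{\mathcal L}$-continuous for every $F\in\mathcal A$, and let $\pi$ be a finitely additive probability on $\mathcal A_{\mathcal L}$. Let $\mathcal P^{\mathbf p}$ be the set of coherent extensions of $\{\pi,\sigma\}$ to $\mathcal A_{\mathcal L}\times\mathcal A_{\mathcal L}^0$, i.e. of restrictions to $\mathcal A_{\mathcal L}\times\mathcal A_{\mathcal L}^0$ of full conditional probabilities on $\mathcal A$ extending $\{\pi,\sigma\}$. Then its pointwise lower envelope $\underline\pi^{\mathbf p}=\min\mathcal P^{\mathbf p}$ satisfies: (i) $\underline\pi^{\mathbf p}(\cdot|K)$ is totally monotone on $\mathcal A_{\mathcal L}$, for every $K\in\mathcal A_{\mathcal L}^0$; (ii) for every $F|K\in\mathcal A_{\mathcal L}\times\mathcal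 A_{\mathcal L}^0$, $\underline\pi^{\mathbf p}(F|K)=1$ when $F\wedge K=K$, and if $F\wedge K\neq K$, $$\underline\pi^{\mathbf p}(F|K)=\begin{cases}\dfrac{\pi(F\wedge K)}{\pi(K)}&\text{if }\pi(K)>0,\\[1ex]0&\text{otherwise}.\end{cases}$$
   Context: Events are elements of a Boolean algebra with operations $\wedge,\vee,(\cdot)^c$, implication order $\subseteq$, top $\Omega$ and bottom $\emptyset$; $\mathcal A^0=\mathcal A\setminus\{\emptyset\}$, $\mathcal A_{\mathcal L}^0=\mathcal A_{\mathcal L}\setminus\{\emptyset\}$. For a set $\mathcal G$ of events, $\langle\mathcal G\rangle$ is the Boolean algebra generated by $\mathcal G$, and $\langle\mathcal G\rangle^*$ is the complete atomic Boolean algebra generated by $\mathcal G$ (the minimal atomic Boolean algebra containing $\mathcal G$ and closed under arbitrary conjunctions and disjunctions). A partition of $\Omega$ is a family of pairwise incompatible non-impossible events with disjunction $\Omega$. The atoms of $\mathcal A$ are the events $H_i\wedge E_j\neq\emptyset$. A conditional event $E|H$ is a pair of events $(E,H)$ with $H\neq\emptyset$. Strategy: a map $\sigma:\mathcal A\times\mathcal L\to[0,1]$ such that for every $H_i\in\mathcal L$: (S1) $\sigma(F|H_i)=1$ for every $F\in\mathcal A$ with $F\wedge H_i=H_i$; (S2) $\sigma(\cdot|H_i)$ is a finitely additive probability on $\mathcal A$. Full conditional probability (f.c.p.) on $\mathcal A$: a function $P:\mathcal A\times\mathcal A^0\to[0,1]$ with (C1) $P(E|H)=P(E\wedge H|H)$;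 (C2) $P(\cdot|H)$ is a finitely additive probability on $\mathcal A$ for every $H\in\mathcal A^0$; (C3) $P(E\wedge F|H)=P(E|H)\,P(F|E\wedge H)$ whenever $H,E\wedge H\in\mathcal A^0$, $E,F\in\mathcal A$. It extends $\{\pi,\sigma\}$ if $P(B|\Omega)=\pi(B)$ for $B\in\mathcal A_{\mathcal L}$ and $P(F|H_i)=\sigma(F|H_i)$ for $F\in\mathcal A$, $H_i\in\mathcal L$. A function $X:\mathcal L\to\mathbb R$ is $\mathcal A_{\mathcal L}$-continuous if it is bounded and for every $t\in\mathbb R$, $\epsilon>0$ there is $A\in\mathcal A_{\mathcal L}$ with $(X\ge t)\supseteq A\supseteq(X\ge t+\epsilon)$, where $(X\ge t)=\bigvee\{H_i\in\mathcal L: X(H_i)\ge t\}$. A capacity on a Boolean algebra $\mathcal D$ is $\varphi:\mathcal D\to[0,1]$ with $\varphi(\emptyset)=0$, $\varphi(\Omega)=1$ and $\varphi(A)\le\varphi(B)$ for $A\subseteq B$. It is totally monotone if for every $n\ge2$ and $A_1,\ldots,A_n\in\mathcal D$, $\varphi(\bigvee_{i=1}^nA_i)\ge\sum_{\emptyset\neq S\subseteq\{1,\ldots,n\}}(-1)^{|S|-1}\varphi(\bigwedge_{i\in S}A_i)$. *)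

(* Defs.v *)
From HB Require Import structures.
From mathcomp Require Import all_boot all_order all_algebra.
From mathcomp Require Import boolp classical_sets reals.

Set Implicit Arguments.
Unset Strict Implicit.
Unset Printing Implicit Defensive.

Import Order.TTheory GRing.Theory Num.Theory.

(* Events live in an ambient Boolean algebra B : ctbDistrLatticeType, with
   implication <=, conjunction `&`, disjunction `|`, negation ~`, impossible
   event \bot and sure event \top, all in order_scope (%O). Sets of events are
   classical sets over B. Every function of events below is total on B, but is
   constrained and evaluated only on its mathematical domain. *)

Section Events.
Context {d : Order.disp_t} {B : ctbDistrLatticeType d}.
Implicit Types (A C D G L S : set B).

(* Arbitrary disjunctions exist in B (hence so do arbitrary conjunctions). *)
Definition complete_events : Prop :=
  forall S, exists s, supremums S s.

Definition boolean_subalgebra C : Prop :=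
  [/\ C \bot%O, C \top%O,
      forall x y, C x -> C y -> C (x `&` y)%O,
      forall x y, C x -> C y -> C (x `|` y)%O &
      forall x, C x -> C (~` x)%O].

Definition closed_arbitrary C : Prop :=
  forall S s, (forall x, S x -> C x) ->
    (supremums S s -> C s) /\ (infimums S s -> C s).

Definition atom C (a : B) : Prop :=
  [/\ C a, a <> \bot%O & forall x, C x -> (x <= a)%O -> x = \bot%O \/ x = a].

Definition atomic C : Prop :=
  forall x, C x -> x <> \bot%O -> exists2 a, atom C a & (a <= x)%O.

Definition complete_atomic_subalgebra C : Prop :=
  [/\ boolean_subalgebra C, closed_arbitrary C & atomic C].

Definition generated G : set B := smallest boolean_subalgebra G.

Definition complete_generated G : set B := smallest complete_atomic_subalgebra G.

Definition nonimpossible D : set B := [set x | D x /\ x <> \bot%O].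

Definition partition_of_top (I : Type) (H : I -> B) : Prop :=
  [/\ forall i, H i <> \bot%O,
      forall i j, i <> j -> (H i `&` H j)%O = \bot%O &
      supremums (range H) \top%O].

End Events.

Arguments complete_events {d} B.

Local Open Scope ring_scope.

Section Probability.
Context {R : realType} {d : Order.disp_t} {B : ctbDistrLatticeType d}.
Implicit Types (A AL D L : set B).

Definition fa_probability D (m : B -> R) : Prop :=
  [/\ forall x, D x -> 0 <= m x <= 1,
      m \top%O = 1 &
      forall x y, D x -> D y -> (x `&` y)%O = \bot%O ->
        m (x `|` y)%O = m x + m y].

(* In all conditional functions, s F H stands for s(F|H). *)
Definition strategy A L (s : B -> B -> R) : Prop :=
  forall h, L h ->
    (forall x, A x -> (x `&` h)%O = h -> s x h = 1) /\
    fa_probability A (s^~ h).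

(* The event (X >= t), for X a function on the partition L; the supremum of
   the empty set is \bot. *)
Definition event_ge L (X : B -> R) (t : R) : B :=
  supremum \bot%O [set h | L h /\ t <= X h].

Definition continuous_wrt AL L (X : B -> R) : Prop :=
  (exists M : R, forall h, L h -> `|X h| <= M) /\
  (forall t e : R, 0 < e ->
     exists a, [/\ AL a, (a <= event_ge L X t)%O &
                         (event_ge L X (t + e) <= a)%O]).

Definition full_conditional_probability A (P : B -> B -> R) : Prop :=
  [/\ forall e h, A e -> nonimpossible A h -> P e h = P (e `&` h)%O h,
      forall h, nonimpossible A h -> fa_probability A (P^~ h) &
      forall e f h, A e -> A f -> nonimpossible A h ->
        nonimpossible A (e `&` h)%O ->
        P (e `&` f)%O h = P e h * P f (e `&` h)%O].

Definition extends A AL L (pi : B -> R) (s P : B -> B -> R) : Prop :=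
  (forall b, AL b -> P b \top%O = pi b) /\
  (forall f h, A f -> L h -> P f h = s f h).

Definition coherent_extensions A AL L (pi : B -> R) (s : B -> B -> R) :
    set (B -> B -> R) :=
  [set Q | exists P, [/\ full_conditional_probability A P,
                         extends A AL L pi s P &
                         forall f k, AL f -> nonimpossible AL k ->
                           Q f k = P f k]].

Definition lower_envelope (PP : set (B -> B -> R)) (f k : B) : R :=
  inf [set Q f k | Q in PP].

Definition capacity D (phi : B -> R) : Prop :=
  [/\ forall x, D x -> 0 <= phi x <= 1,
      phi \bot%O = 0,
      phi \top%O = 1 &
      forall x y, D x -> D y -> (x <= y)%O -> phi x <= phi y].

Definition totally_monotone D (phi : B -> R) : Prop :=
  capacity D phi /\
  forall (n : nat) (a : 'I_n -> B), (2 <= n)%N -> (forall i, D (a i)) ->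
    \sum_(S : {set 'I_n} | S != finset.set0)
       (-1) ^+ #|S|.-1 * phi (\meet_(i in S) a i)%O
    <= phi (\join_(i < n) a i)%O.

End Probability.

(* Main.v *)
(* If [pi K > 0], the rule [P(F & K) = P(F|K) P(K)] forces
   [P(F|K) = pi(F & K) / pi K]. If [pi K = 0] and [F & K <> K], some [H i] lies
   below [K] and is disjoint from [F], and it suffices to find a full
   conditional probability with [P(H i|K) = 1]. One is obtained by conditioning
   on the first of a ranked family of probabilities that does not neglect the
   conditioning event: a common extension [m] of [pi] to all of [A] with
   [m(F & H j) = pi(H j) sigma(F|H j)], then [sigma(.|H i)], then every
   [sigma(.|H j)], then the point masses at the atoms of [A]. The extension [m]
   is an ultrafilter limit of the sums [\sum_k pi(k) sigma(.|h_k)] over finite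
   partitions of the sure event in [AL], with [h_k] an element of the partition
   [H] below [k]. Finally, [lpi(.|K)] is either finitely additive or the
   indicator of the events implied by [K], hence totally monotone. *)
Require Import Defs.
From HB Require Import structures.
From mathcomp Require Import all_boot all_order all_algebra.
From mathcomp Require Import ring.
From mathcomp Require Import boolp classical_sets reals wochoice topology normedtype.

Set Implicit Arguments.
Unset Strict Implicit.
Unset Printing Implicit Defensive.

Import Order.Theory GRing.Theory Num.Theory numFieldNormedType.Exports.
Local Open Scope classical_set_scope.
Local Open Scope ring_scope.

(** * Events not split by the cells of a partition *)

Section Events.
Context {d : Order.disp_t} {B : ctbDistrLatticeType d}.
Implicit Types (A C D G S : set B) (h k x y : B).

(** The event [x] does not split [h]. Membership in [complete_generated] is exploited through this
    property alone. *)
Definition decided h x : Prop := (h <= x)%O \/ (h `&` x)%O = \bot%O.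

Lemma disjointP x y : (x `&` y)%O = \bot%O <-> (x <= ~` y)%O.
Proof. by rewrite -disj_leC; split => [->|/eqP//]; rewrite eqxx. Qed.

Lemma decidedC h x : decided h x -> decided h (~` x)%O.
Proof.
move=> [hx|/disjointP hx]; [right; apply/disjointP|by left].
by rewrite complK.
Qed.

Lemma decidedI h x y : decided h x -> decided h y -> decided h (x `&` y)%O.
Proof.
move=> [hx|hx]; last by move=> _; right; rewrite meetA hx meet0x.
move=> [hy|hy]; first by left; rewrite lexI hx.
by right; rewrite meetCA hy meetx0.
Qed.

Lemma decidedU h x y : decided h x -> decided h y -> decided h (x `|` y)%O.
Proof.
move=> /decidedC hx /decidedC hy.
by rewrite -[X in decided h X]complK complU; apply/decidedC/decidedI.
Qed.

(** If no member of [S] contains [h], all of them lie below the complement of [h], which is then an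
    upper bound of [S]. *)
Lemma decided_sup h S s :
  supremums S s -> (forall x, S x -> decided h x) -> decided h s.
Proof.
move=> [ubs lubs] Sh; have [[x Sx hx]|nS] := pselect (exists2 x, S x & (h <= x)%O).
  by left; apply: le_trans hx (ubs _ Sx).
right; rewrite meetC; apply/disjointP/lubs => x Sx; apply/disjointP; rewrite meetC.
by case: (Sh _ Sx) => // hx; case: nS; exists x.
Qed.

Lemma decided_inf h S s :
  infimums S s -> (forall x, S x -> decided h x) -> decided h s.
Proof.
move=> [lbs glbs] Sh; have [[x Sx hx]|nS] :=
  pselect (exists2 x, S x & (h `&` x)%O = \bot%O).
  by right; apply/eqP; rewrite -lex0 -hx leI2 ?lexx //; exact: lbs.
by left; apply: glbs => x Sx; case: (Sh _ Sx) => // hx; case: nS; exists x.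
Qed.

(** A partition as a set rather than a family, so that a common refinement needs no index type. The
    last clause says that the supremum is [\top]. *)
Definition set_partition D : Prop :=
  [/\ forall h, D h -> h <> \bot%O,
      forall h k, D h -> D k -> h <> k -> (h `&` k)%O = \bot%O &
      forall u, (forall h, D h -> (h <= u)%O) -> u = \top%O].

(** Otherwise every cell misses [x], so the complement of [x] bounds all cells and equals [\top]. *)
Lemma set_partition_below D x : set_partition D ->
    (forall h, D h -> decided h x) -> x <> \bot%O ->
  exists2 h, D h & (h <= x)%O.
Proof.
move=> [D0 _ DT] Dx x0; apply: contrapT => nD; apply: x0.
rewrite -[x]complK [X in (~` X)%O]DT ?compl1 // => h Dh.
by apply/disjointP; case: (Dx _ Dh) => // hx; case: nD; exists h.
Qed.

Lemma set_partition_decided D h k :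
  set_partition D -> D h -> D k -> decided h k.
Proof.
move=> [_ DI _] Dh Dk; have [->|hk] := pselect (h = k); first by left.
by right; exact: DI.
Qed.

(** This algebra, whose atoms include the cells, competes in the intersection defining
    [complete_generated]; hence generated events inherit being decided. *)
Lemma complete_atomic_decided D : set_partition D ->
  complete_atomic_subalgebra [set x | forall h, D h -> decided h x].
Proof.
move=> Dp; have [D0 _ _] := Dp; split.
- split=> /=.
  + by move=> h _; right; rewrite meetx0.
  + by move=> h _; left; rewrite lex1.
  + by move=> x y Cx Cy h Dh; apply: decidedI; [exact: Cx|exact: Cy].
  + by move=> x y Cx Cy h Dh; apply: decidedU; [exact: Cx|exact: Cy].
  + by move=> x Cx h Dh; apply/decidedC/Cx.
- move=> S s SC; split=> Ss h Dh.
  + by apply: decided_sup Ss _ => x /SC; apply.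
  + by apply: decided_inf Ss _ => x /SC; apply.
- move=> x Cx /(set_partition_below Dp Cx)[h Dh hx]; exists h => //; split.
  + by move=> k Dk; exact: set_partition_decided Dp Dk Dh.
  + exact: D0.
  + move=> y /(_ _ Dh)[hy yh|hy yh]; [right|left].
      by apply/eqP; rewrite eq_le yh.
    by rewrite -hy; apply/esym/meet_r.
Qed.

Lemma complete_generated_decided D G : set_partition D ->
    (forall h x, D h -> G x -> decided h x) ->
  forall h x, D h -> complete_generated G x -> decided h x.
Proof.
move=> Dp GD h x Dh /(_ [set y | forall h, D h -> decided h y]); apply => //.
split; first exact: complete_atomic_decided.
by move=> y Gy k Dk; exact: GD.
Qed.

Lemma partition_of_top_range (I : Type) (H : I -> B) :
  partition_of_top H -> set_partition (range H).
Proof.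
move=> [H0 HI [_ HT]]; split.
- by move=> _ [i _ <-].
- by move=> _ _ [i _ <-] [j _ <-] ij; apply: HI => // e; apply: ij; rewrite e.
- by move=> u Hu; apply/eqP; rewrite -le1x; apply: HT => _ [i _ <-]; apply: Hu; exists i.
Qed.

(** The common refinement; for [range H] and [range E] its members are the atoms of the algebra
    [A]. *)
Definition set_meet D D' : set B :=
  [set x | x <> \bot%O /\ exists h k, [/\ D h, D' k & x = (h `&` k)%O]].

Lemma set_partition_meet D D' :
  set_partition D -> set_partition D' -> set_partition (set_meet D D').
Proof.
move=> [D0 DI DT] [D'0 D'I D'T]; split.
- by move=> x [].
- move=> _ _ [_ [h [k [Dh D'k ->]]]] [_ [h' [k' [Dh' D'k' ->]]]] ne.
  rewrite meetACA; have [ee|hh'] := pselect (h = h').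
    rewrite (D'I k k') ?meetx0 // => e'; by apply: ne; rewrite ee e'.
  by rewrite (DI h h') ?meet0x.
- move=> u hu; apply: DT => h Dh.
  (* Moving [h] to the right as a complement turns [h <= u] into an upper bound statement for [D'],
     so no infinite distributivity is invoked. *)
  suff : (~` h `|` u)%O = \top%O.
    by move=> e; rewrite -[h]meetx1 -e meetUr meetxC join0x leIr.
  apply: D'T => k D'k; have [hk|hk] := pselect ((h `&` k)%O = \bot%O).
    by apply: lexUl; apply/disjointP; rewrite meetC.
  have /(leU2 (lexx (~` h)%O)) : (h `&` k <= u)%O.
    by apply: hu; split=> //; exists h, k.
  apply: le_trans; rewrite joinIr joinCx meet1x; exact: leUr.
Qed.

Lemma decided_meet h k x :
  decided h x \/ decided k x -> decided (h `&` k)%O x.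
Proof.
move=> [] [hx|hx].
- by left; apply: leIxl.
- by right; rewrite meetAC hx meet0x.
- by left; apply: leIxr.
- by right; rewrite -meetA hx meetx0.
Qed.

End Events.

Section Probability.
Context {R : realType} {d : Order.disp_t} {B : ctbDistrLatticeType d}.
Implicit Types (A AL L : set B) (m : B -> R) (x y h k : B).

(** * Elementary calculus of finitely additive probabilities *)

Section FinitelyAdditive.
Variables (A : set B) (hA : boolean_subalgebra A) (m : B -> R).
Hypothesis hm : fa_probability A m.

Let AI x y : A x -> A y -> A (x `&` y)%O. Proof. by case: hA => ? ? + *; apply. Qed.
Let AC x : A x -> A (~` x)%O. Proof. by case: hA => ? ? ? ? +; apply. Qed.

Lemma fa_probability_ge0 x : A x -> 0 <= m x.
Proof. by case: hm => + _ _ => /[apply] /andP[]. Qed.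

Lemma fa_probability_bot : m \bot%O = 0.
Proof.
case: hA => A0 _ _ _ _; case: hm => _ _ /(_ _ _ A0 A0).
by rewrite meetxx joinxx => /(_ erefl) e; apply: (addrI (m \bot%O)); rewrite addr0.
Qed.

Lemma fa_probability_split x y : A x -> A y ->
  m x = m (x `&` y)%O + m (x `&` ~` y)%O.
Proof.
move=> Ax Ay; case: hm => _ _ <-; rewrite -?meetUr ?joinxC ?meetx1 //.
- exact: AI.
- exact/AI/AC.
- by rewrite meetACA meetxC meetx0.
Qed.

Lemma fa_probability_mono x y : A x -> A y -> (x <= y)%O -> m x <= m y.
Proof.
move=> Ax Ay /meet_r xy; rewrite (fa_probability_split Ay Ax) xy lerDl.
exact/fa_probability_ge0/AI/AC.
Qed.

Lemma fa_probability_null x y :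
  A x -> A y -> (x <= y)%O -> m y = 0 -> m x = 0.
Proof.
move=> Ax Ay xy my; apply/eqP; rewrite eq_le fa_probability_ge0 // andbT -my.
exact: fa_probability_mono.
Qed.

Lemma fa_probability_meet_sure x y : A x -> A y -> m y = 1 ->
  m (x `&` y)%O = m x.
Proof.
move=> Ax Ay my; rewrite (fa_probability_split Ax Ay).
rewrite (@fa_probability_null (x `&` ~` y)%O (~` y)%O) ?addr0 ?leIr //; last 1 first.
- case: hA hm => _ A1 _ _ _ [_ m1 _]; have := fa_probability_split A1 Ay.
  by rewrite !meet1x m1 my => e; apply: (addrI 1); rewrite addr0.
- exact/AI/AC.
- exact: AC.
Qed.

Lemma fa_probability_conditional k : A k -> 0 < m k ->
  fa_probability A (fun x => m (x `&` k)%O / m k).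
Proof.
move=> Ak mk; split.
- move=> x Ax; rewrite divr_ge0 ?(ltW mk) ?fa_probability_ge0 ?ler_pdivrMr ?mul1r //.
    by rewrite fa_probability_mono ?leIr //; exact: AI.
  exact: AI.
- by rewrite meet1x divff // gt_eqF.
- move=> x y Ax Ay xy; rewrite -mulrDl meetUl; congr (_ / _).
  case: hm => _ _ -> //; first exact: AI.
    exact: AI.
  by rewrite meetACA xy meet0x.
Qed.

End FinitelyAdditive.

(** * Full conditional probabilities from ranked families *)

(* Minimizing first the rank and then a well-order makes the choice stable:
   the point chosen in a set is also chosen in every subset containing it. *)
Lemma ranked_choice (T : eqType) (t0 : T) (r : T -> nat) :
  exists f : set T -> T, forall S, S !=set0 ->
    [/\ S (f S), forall t, S t -> (r (f S) <= r t)%N &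
        forall S', S' `<=` S -> S' (f S) -> f S' = f S].
Proof.
have [W Wwo] := well_ordering_principle T.
pose M (S : set T) := [set t | S t /\ forall t', S t' -> (r t <= r t')%N].
have minP S : S !=set0 -> exists! z, minimum_of W (fun t => `[< M S t >]) z.
  move=> [t St]; apply: Wwo.
  have /ex_minnP[_ /asboolP[u Su <-] umin] :
    exists n, `[< exists2 u, S u & r u = n >] by exists (r t); apply/asboolP; exists t.
  exists u; apply/asboolP; split=> // t' St'; apply: umin.
  by apply/asboolP; exists t'.
have fP S : exists z, S !=set0 -> minimum_of W (fun t => `[< M S t >]) z.
  have [/minP[z [zmin _]]|S0] := pselect (S !=set0); first by exists z.
  by exists t0 => /S0.
have {fP}[f fP] := choice fP; exists f => S S0.
have [/asboolP[SfS rmin] Wmin] := fP _ S0; split=> // S' S'S S'fS.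
have S'0 : S' !=set0 by exists (f S).
have [z [_ zuniq]] := minP _ S'0.
(* Both [f S'] and [f S] are least in [M S']: since [f S] lies in [S'], a point of minimal rank in
   [S'] also has minimal rank in [S]. *)
rewrite -(zuniq _ (fP _ S'0)) -(zuniq (f S)) //; split.
  by apply/asboolP; split=> // t /S'S/rmin.
move=> t /asboolP[S't tmin]; apply: Wmin; apply/asboolP.
split; first exact: S'S.
by move=> t' /rmin; apply: leq_trans; exact: tmin.
Qed.

(** Each [k] is conditioned by the measure chosen among those charging it. For the product rule, if
    that measure charges [x & k] it is chosen there too by stability; if not, both sides vanish. *)
Lemma layered_full_conditional_probability A (T : eqType) (u0 : T)
    (V : set T) (r : T -> nat) (mu : T -> B -> R) :
    boolean_subalgebra A ->
    (forall t, V t -> fa_probability A (mu t)) ->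
    (forall k, nonimpossible A k -> exists2 t, V t & 0 < mu t k) ->
  exists2 P, full_conditional_probability A P &
    forall k, nonimpossible A k -> exists t,
      [/\ V t, 0 < mu t k, forall t', V t' -> 0 < mu t' k -> (r t <= r t')%N &
          forall x, P x k = mu t (x `&` k)%O / mu t k].
Proof.
move=> hA hmu hV; have [f hf] := ranked_choice u0 r.
pose S k := [set t | V t /\ 0 < mu t k].
have S0 k : nonimpossible A k -> S k !=set0 by move=> /hV[t]; exists t.
have AI x y : A x -> A y -> A (x `&` y)%O by case: hA => ? ? + *; apply.
exists (fun x k => mu (f (S k)) (x `&` k)%O / mu (f (S k)) k); last first.
  move=> k /S0/hf[[Vt t0] rmin _]; exists (f (S k)); split=> // t' Vt' t'0.
  exact: rmin.
split.
- by move=> x k _ _; rewrite -meetA meetxx.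
- move=> k Ak; have [[Vt t0] _ _] := hf _ (S0 _ Ak).
  by apply: fa_probability_conditional => //; [exact: hmu|case: Ak].
- move=> x y k Ax Ay Ak Axk; have [[Vt t0] _ stable] := hf _ (S0 _ Ak).
  have [Ak' _] := Ak; have [Axk' _] := Axk.
  set t := f (S k) in t0 Vt stable *; have ht := hmu _ Vt.
  have [xk0|xk0] := eqVneq (mu t (x `&` k)%O) 0.
    rewrite xk0 !mul0r (fa_probability_null hA ht _ Axk' _ xk0) ?mul0r //.
      by apply/AI => //; exact: AI.
    by rewrite meetAC leIl.
  have xk_gt0 : 0 < mu t (x `&` k)%O.
    by rewrite lt_neqAle eq_sym xk0 (fa_probability_ge0 ht).
  have -> : f (S (x `&` k)%O) = t.
    apply: stable => // t' [Vt' /lt_le_trans-t'0]; split=> //; apply: t'0.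
    by apply: (fa_probability_mono hA (hmu _ Vt')) => //; exact: leIr.
  rewrite meetCA meetA [(mu t (x `&` k)%O / _) * _]mulrC mulrA divfK //.
Qed.

(** * One probability on [A] mixing [sigma] according to [pi] *)

Section GlobalExtension.
Variables (A AL L : set B).
Hypotheses (hA : boolean_subalgebra A) (hAL : boolean_subalgebra AL).
Hypotheses (LAL : L `<=` AL) (ALA : AL `<=` A) (hL : set_partition L).
Hypothesis ALdec : forall h x, L h -> AL x -> decided h x.
Variables (sigma : B -> B -> R) (pi : B -> R).
Hypotheses (hsigma : strategy A L sigma) (hpi : fa_probability AL pi).

Let ALI x y : AL x -> AL y -> AL (x `&` y)%O. Proof. by case: hAL => ? ? + *; apply. Qed.
Let ALC x : AL x -> AL (~` x)%O. Proof. by case: hAL => ? ? ? ? +; apply. Qed.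
Let ALT : AL \top%O. Proof. by case: hAL. Qed.

(* The sum runs over the cells [k'] of the partition of [k] generated by [s]. *)
Fixpoint tagged_sum (tag : B -> B) (s : seq B) k x : R :=
  if s is y :: s' then
    tagged_sum tag s' (k `&` y)%O x + tagged_sum tag s' (k `&` ~` y)%O x
  else pi k * sigma x (tag k).

Definition events_in (s : seq B) : Prop := forall y, y \in s -> AL y.

Section TaggedSum.
Variable tag : B -> B.
Hypothesis htag : forall k, AL k -> k <> \bot%O -> L (tag k) /\ (tag k <= k)%O.

(** Covers the arbitrary value of [tag] at [\bot], where the weight [pi] vanishes. *)
Let tag_case k : AL k -> pi k = 0 \/ L (tag k) /\ (tag k <= k)%O.
Proof.
move=> ALk; have [->|k0] := pselect (k = \bot%O).
  by left; exact: (fa_probability_bot hAL hpi).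
by right; exact: htag.
Qed.

Let events_in_cons y s : events_in (y :: s) -> AL y /\ events_in s.
Proof. by move=> hs; split=> [|z zs]; apply: hs; rewrite inE ?eqxx// zs orbT. Qed.

Lemma tagged_sum_ge0 s k x : events_in s -> AL k -> A x ->
  0 <= tagged_sum tag s k x.
Proof.
move=> + + Ax; elim: s k => [|y s IH] k /= hs ALk.
  have [->|[Lk _]] := tag_case ALk; first by rewrite mul0r.
  rewrite mulr_ge0 ?(fa_probability_ge0 hpi) //.
  exact: fa_probability_ge0 (hsigma Lk).2 _ Ax.
have [ALy {}hs] := events_in_cons hs.
by rewrite addr_ge0 ?IH //; apply: ALI => //; exact: ALC.
Qed.

Lemma tagged_sum_add s k x y : events_in s -> AL k -> A x -> A y ->
    (x `&` y)%O = \bot%O ->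
  tagged_sum tag s k (x `|` y)%O = tagged_sum tag s k x + tagged_sum tag s k y.
Proof.
move=> + + Ax Ay xy; elim: s k => [|z s IH] k /= hs ALk.
  have [->|[Lk _]] := tag_case ALk; first by rewrite !mul0r addr0.
  by have [_ _ ->] := (hsigma Lk).2; rewrite // mulrDr.
have [ALz {}hs] := events_in_cons hs.
rewrite !IH //; first by rewrite addrACA.
- exact/ALI/ALC.
- exact: ALI.
Qed.

(** Every cell cut from [k] stays on the same side of [y], and so does its tag; each term is the
    mass of the cell times [c], or zero. *)
Lemma tagged_sum_decided s k x y c : events_in s -> AL k -> AL y ->
    (forall h, L h -> (h <= y)%O -> sigma x h = c) ->
    (forall h, L h -> (h <= ~` y)%O -> sigma x h = 0) ->
    (k <= y)%O \/ (k <= ~` y)%O ->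
  tagged_sum tag s k x = pi (k `&` y)%O * c.
Proof.
move=> + + ALy xc x0; elim: s k => [|z s IH] k /= hs ALk ky.
  have [pk0|[Lk tk]] := tag_case ALk.
    by rewrite (fa_probability_null hAL hpi _ ALk (leIl _ _)) ?pk0 ?mul0r //; exact: ALI.
  case: ky => ky; first by rewrite (meet_l ky) (xc _ Lk) // (le_trans tk).
  have /disjointP -> := ky.
  by rewrite (x0 _ Lk) ?(le_trans tk) // (fa_probability_bot hAL hpi) mulr0 mul0r.
have [ALz {}hs] := events_in_cons hs.
have ALkz : AL (k `&` z)%O by exact: ALI.
have ALkCz : AL (k `&` ~` z)%O by exact/ALI/ALC.
rewrite !IH //; try by case: ky => ky; [left|right]; exact: leIxl.
rewrite -mulrDl; congr (_ * _).
rewrite (fa_probability_split hAL hpi (_ : AL (k `&` y)%O) ALz); last exact: ALI.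
by rewrite ![(_ `&` y `&` _)%O]meetAC.
Qed.

(** Once [y] is a splitting event, each final cell lies on one side of it. The sum is thus exact for
    every [s] containing [y], not just in the limit. *)
Lemma tagged_sum_mem s k x y c : events_in s -> AL k -> y \in s ->
    (forall h, L h -> (h <= y)%O -> sigma x h = c) ->
    (forall h, L h -> (h <= ~` y)%O -> sigma x h = 0) ->
  tagged_sum tag s k x = pi (k `&` y)%O * c.
Proof.
move=> + + + xc x0; elim: s k => [//|z s IH] k hs ALk.
rewrite inE => yzs; have ALy := hs y yzs; have [ALz {}hs] := events_in_cons hs.
have ALkz : AL (k `&` z)%O by exact: ALI.
have ALkCz : AL (k `&` ~` z)%O by exact/ALI/ALC.
have split_k : pi (k `&` y)%O = pi (k `&` z `&` y)%O + pi (k `&` ~` z `&` y)%O.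
  rewrite (fa_probability_split hAL hpi (_ : AL (k `&` y)%O) ALz); last exact: ALI.
  by rewrite ![(_ `&` y `&` _)%O]meetAC.
rewrite /= split_k mulrDl; case/orP: yzs => [/eqP eyz|ys]; last by rewrite !IH.
congr (_ + _); apply: tagged_sum_decided => //; rewrite eyz leIr; by [left|right].
Qed.

End TaggedSum.

(** Compactness of the segment gives a cluster point, and an ultrafilter converges to its cluster
    points. *)
Lemma ultra_bounded_cvg (T : Type) (U : set_system T) (a b : R) (f : T -> R) :
    UltraFilter U -> (\forall t \near U, a <= f t <= b) ->
  exists l : R, f @ U --> l.
Proof.
move=> UU fab; have /(_ (f @ U) _)[|l [_ cl]] := @segment_compact R a b.
  by apply: filterS fab => t; rewrite /= in_itv.
exists l => V Vl; have [//|nV] := in_ultra_setVsetC (f @^-1` V) UU.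
by have [y [nVy Vy]] := cl (~` V)%classic V nV Vl.
Qed.

(** For fixed [s] the tagged sum is a finitely additive probability, a property kept by limits. Both
    identities concern sums that are constant as soon as [s] contains [x], respectively [h]. *)
Lemma global_extension : exists m, [/\ fa_probability A m,
  forall x, AL x -> m x = pi x &
  forall x h, A x -> L h -> m (x `&` h)%O = pi h * sigma x h].
Proof.
have tagP k : exists h, AL k -> k <> \bot%O -> L h /\ (h <= k)%O.
  have [[ALk k0]|nk] := pselect (AL k /\ k <> \bot%O); last first.
    by exists \bot%O => ALk k0; case: nk.
  have [h Lh hk] := set_partition_below hL (fun h Lh => ALdec Lh ALk) k0.
  by exists h.
have {tagP}[tag tagP] := choice tagP.
(* The filter of refinement: along it, any given finite family of events of [AL] is eventually
   contained in [s]. *)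
pose F : set_system (seq B) := [set S | exists2 s0, events_in s0 &
  forall s, events_in s -> {subset s0 <= s} -> S s].
have PF : ProperFilter F.
  split; first by move=> [s0 hs0 /(_ s0 hs0)]; apply.
  split.
  - by exists [::].
  - move=> P Q [s hs Ps] [t ht Qt]; exists (s ++ t).
      by move=> y; rewrite mem_cat => /orP[/hs|/ht].
    move=> u hu stu; split; [apply: Ps|apply: Qt] => // y ys; apply: stu;
      by rewrite mem_cat ys ?orbT.
  - by move=> P Q PQ [s hs Ps]; exists s => // u hu su; apply/PQ/Ps.
have [U [UU FU]] := ultraFilterLemma PF.
have Uin : \forall s \near U, events_in s by apply: FU; exists [::].
have Umem y : AL y -> \forall s \near U, y \in s.
  move=> ALy; apply: FU; exists [:: y] => [z|s _ ys].
    by rewrite inE => /eqP->.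
  by apply: ys; rewrite inE.
pose f x s := tagged_sum tag s \top%O x.
have fT s : events_in s -> f \top%O s = 1.
  have [_ piT _] := hpi; move=> hs.
  rewrite -[1]mulr1 -[X in X * _]piT -[X in pi X](meetxx \top%O).
  apply: tagged_sum_decided => //.
  - by move=> h Lh _; case: (hsigma Lh).2.
  - by rewrite compl1 => h Lh; rewrite lex0 => /eqP h0; case: hL => /(_ _ Lh).
  - by left.
have fge0 x s : A x -> events_in s -> 0 <= f x s.
  by move=> Ax hs; exact: tagged_sum_ge0.
have AC x : A x -> A (~` x)%O by case: hA => ? ? ? ? +; apply.
have fadd x y s : A x -> A y -> (x `&` y)%O = \bot%O -> events_in s ->
    f (x `|` y)%O s = f x s + f y s.
  by move=> *; exact: tagged_sum_add.
have fle1 x s : A x -> events_in s -> f x s <= 1.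
  move=> Ax hs; have ACx := AC _ Ax.
  by rewrite -(fT s hs) -(joinxC x) fadd ?meetxC // lerDl fge0.
have limP x : exists l : R, A x -> f x @ U --> l.
  have [Ax|nAx] := pselect (A x); last by exists 0.
  have [|l fl] := @ultra_bounded_cvg _ U 0 1 (f x) UU; last by exists l.
  by apply: filterS Uin => s hs; rewrite fge0 ?fle1.
have {limP}[m mP] := choice limP.
have m_eq x c : A x -> (\forall s \near U, f x s = c) -> m x = c.
  move=> Ax fc; apply: (@cvg_unique _ (@Rhausdorff R) (f x @ U)); first exact: mP.
  exact: cvg_near_cst.
have f_mem x y c s : events_in s -> y \in s ->
    (forall h, L h -> (h <= y)%O -> sigma x h = c) ->
    (forall h, L h -> (h <= ~` y)%O -> sigma x h = 0) ->
  f x s = pi y * c.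
  by move=> *; rewrite -[X in pi X]meet1x; exact: tagged_sum_mem.
have A_T : A \top%O by case: hA.
have sigma_meet x y h : A x -> A y -> L h -> (h <= y)%O -> sigma (x `&` y)%O h = sigma x h.
  move=> Ax Ay Lh /meet_r hy; have [s1 sfa] := hsigma Lh.
  by rewrite (fa_probability_meet_sure hA sfa) // s1 // meetC hy.
have sigma_disj x y h : A x -> A y -> L h -> (h <= ~` y)%O -> sigma (x `&` y)%O h = 0.
  move=> Ax Ay Lh hy; have [s1 sfa] := hsigma Lh.
  rewrite -(fa_probability_meet_sure hA sfa _ (AC _ Ay)).
  - by rewrite -meetA meetxC meetx0 (fa_probability_bot hA sfa).
  - by case: hA => ? ? + _ _; apply.
  - by apply: s1; [exact: AC|exact: meet_r].
exists m; split.
- split.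
  + move=> x Ax; have fx := mP x Ax.
    apply/andP; split; [apply: (cvgr_to_ge fx)|apply: (cvgr_to_le fx)];
      by apply: filterS Uin => s hs; rewrite ?fge0 ?fle1.
  + by apply: m_eq => //; apply: filterS Uin.
  + move=> x y Ax Ay xy; have Axy : A (x `|` y)%O by case: hA => ? ? ? + _; apply.
    apply: (@cvg_unique _ (@Rhausdorff R) (f (x `|` y)%O @ U)); first exact: mP.
    apply: cvg_trans (cvgD (mP x Ax) (mP y Ay)); apply: near_eq_cvg.
    by apply: filterS Uin => s hs; rewrite /= fadd.
- move=> x ALx; have Ax := ALA ALx; apply: m_eq => //.
  near=> s; rewrite -[pi x]mulr1; apply: f_mem.
  + by near: s.
  + by near: s; exact: Umem.
  + by move=> h Lh /meet_r hx; apply: (hsigma Lh).1 => //; rewrite meetC.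
  + by move=> h Lh hx; rewrite -[x]meetxx; exact: sigma_disj.
- move=> x h Ax Lh; have ALh := LAL Lh; have Ah := ALA ALh.
  apply: m_eq; first by case: hA => ? ? + _ _; apply.
  near=> s; apply: f_mem.
  + by near: s.
  + by near: s; exact: Umem.
  (* The only cell below [h] is [h] itself, so the constant is [sigma x h]. *)
  + move=> k Lk kh; have -> : k = h.
      have [k0 kI _] := hL; apply: contrapT => /(kI _ _ Lk Lh).
      by rewrite (meet_l kh); exact: k0.
    exact: sigma_meet.
  + by move=> k Lk kh; exact: sigma_disj.
Unshelve. all: by end_near.
Qed.

End GlobalExtension.

(** Additivity holds because [h], deciding all events of [A], lies below a disjunction only through
    one of its terms. *)
Lemma fa_probability_point A h : h <> \bot%O ->
  (forall x, A x -> decided h x) -> fa_probability A (fun x => (h <= x)%O%:R : R).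
Proof.
move=> h0 hdec; split.
- by move=> x _; case: (h <= x)%O; rewrite ?lexx ler01.
- by rewrite lex1.
- move=> x y Ax Ay xy.
  have [hx|hx] := hdec x Ax.
    rewrite hx (le_trans hx (leUl _ _)); case hy: (h <= y)%O; last by rewrite addr0.
    by case: h0; apply/eqP; rewrite -lex0 -xy lexI hx.
  rewrite (disjoint_lexUr _ hx); case hx' : (h <= x)%O; last by rewrite add0r.
  by case: h0; rewrite -hx; apply/esym/meet_l.
Qed.

(** * Coherent extensions and the values of their lower envelope *)

Section CoherentExtension.
Variables (A AL L D : set B).
Hypotheses (hA : boolean_subalgebra A) (hAL : boolean_subalgebra AL).
Hypotheses (LAL : L `<=` AL) (ALA : AL `<=` A) (hL : set_partition L).
Hypothesis ALdec : forall h x, L h -> AL x -> decided h x.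
Hypothesis hD : set_partition D.
Hypothesis Adec : forall h x, D h -> A x -> decided h x.
Variables (sigma : B -> B -> R) (pi : B -> R).
Hypotheses (hsigma : strategy A L sigma) (hpi : fa_probability AL pi).

(** The measure [sigma^~ k] is concentrated on [k]. Hence, among the strategy layers, a cell is
    charged only by its own measure. *)
Lemma strategy_pos_eq h k : L h -> L k -> 0 < sigma h k -> h = k.
Proof.
move=> Lh Lk; have [s1 sfa] := hsigma Lk; apply: contraPP => hk.
have hk0 : (h `&` k)%O = \bot%O by case: hL => _ /(_ h k Lh Lk hk).
rewrite -(fa_probability_meet_sure hA sfa (ALA (LAL Lh)) (ALA (LAL Lk))).
  by rewrite hk0 (fa_probability_bot hA sfa) ltxx.
by apply: s1; [exact/ALA/LAL|rewrite meetxx].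
Qed.

Lemma strategy_self h : L h -> sigma h h = 1.
Proof.
move=> Lh; have [s1 _] := hsigma Lh; apply: s1; last exact: meetxx.
exact/ALA/LAL.
Qed.

(* The strategy at [h0] is ranked just below the global probability, so that it
   decides every conditioning event neglected by [pi] and containing [h0]. *)
Lemma full_extension_avoiding h0 : L h0 ->
  exists P, [/\ full_conditional_probability A P, extends A AL L pi sigma P &
    forall x k, A x -> AL k -> pi k = 0 -> (h0 <= k)%O ->
      (h0 `&` x)%O = \bot%O -> P x k = 0].
Proof.
move=> Lh0; have [m [mfa mpi msigma]] :=
  global_extension hA hAL LAL ALA hL ALdec hsigma hpi.
have A_I x y : A x -> A y -> A (x `&` y)%O by case: hA => ? ? + *; apply.
(* The first component is the rank. Ranks from 3 on carry the point masses, which ensure that every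
   nonimpossible event is charged. *)
pose V : set (nat * B) := [set t | match t.1 with
  | 0 => True | 1 => t.2 = h0 | 2 => L t.2 | _ => D t.2 end].
pose mu (t : nat * B) : B -> R := match t.1 with
  | 0 => m | 1 | 2 => sigma^~ t.2 | _ => fun x => (t.2 <= x)%O%:R end.
have mufa t : V t -> fa_probability A (mu t).
  case: t => -[|[|[|n]]] h; rewrite /V /mu /=.
  - by [].
  - by move=> ->; exact: (hsigma Lh0).2.
  - by move=> Lh; exact: (hsigma Lh).2.
  - move=> Dh; apply: fa_probability_point => //; first by case: hD => /(_ _ Dh).
    by move=> x; exact: Adec.
have mupos k : nonimpossible A k -> exists2 t, V t & 0 < mu t k.
  move=> [Ak k0].
  have [h Dh hk] := set_partition_below hD (fun h Dh => Adec Dh Ak) k0.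
  by exists (3%N, h); rewrite /V /mu /= ?hk ?ltr01.
have [P Pfcp PE] := layered_full_conditional_probability
  (0%N, h0) (fst : nat * B -> nat) hA mufa mupos.
have sigma_gt0 h : L h -> 0 < mu (2%N, h) h by move=> Lh; rewrite /mu /= strategy_self ?ltr01.
have L_nonimp h : L h -> nonimpossible A h.
  by move=> Lh; split; [exact/ALA/LAL|case: hL => /(_ _ Lh)].
have AL_T : AL \top%O by case: hAL.
exists P; split=> //.
- split.
  + move=> x ALx; have T_nonimp : nonimpossible A (\top%O : B).
      split; first exact: ALA.
      case: hpi => _ + _ => /[swap] ->; rewrite (fa_probability_bot hAL hpi).
      by move/eqP; rewrite eq_sym oner_eq0.
    have mT : m \top%O = 1 by case: mfa.
    have [[[|n] h] [_ _ /(_ (0%N, h0) I) rmin Px]] := PE _ T_nonimp.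
      by rewrite Px /mu /= mT divr1 meetx1 mpi.
    by have := rmin; rewrite /mu /= mT ltr01 => /(_ erefl).
  + move=> x h Ax Lh; have [[n k] [Vt t0 rmin ->]] := PE _ (L_nonimp _ Lh).
    have sigmaE : sigma (x `&` h)%O h / sigma h h = sigma x h.
      rewrite strategy_self // divr1.
      have [_ sfa] := hsigma Lh; apply: (fa_probability_meet_sure hA sfa) => //.
        exact/ALA/LAL.
      exact: strategy_self.
    (* At rank 0 the factor [pi h] cancels; at ranks 1 and 2 the measure is [sigma^~ h]; higher
       ranks lose to [sigma^~ h], which charges [h] at rank 2. *)
    move: n Vt t0 rmin; rewrite /V /mu => -[|[|[|n]]] /= Vt t0 rmin.
    * rewrite msigma // mulrAC -(mpi h (LAL Lh)) divff ?mul1r //.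
      by rewrite gt_eqF.
    * by move: t0; rewrite Vt => /(strategy_pos_eq Lh Lh0) <-.
    * by rewrite -(strategy_pos_eq Lh Vt t0).
    * by have := rmin (2%N, h) Lh (sigma_gt0 _ Lh).
- move=> x k Ax ALk pk0 h0k h0x; have Ak := ALA ALk.
  have k_nonimp : nonimpossible A k.
    split=> // k0; have [_ h00] := L_nonimp _ Lh0; apply: h00.
    by apply/eqP; rewrite -lex0 -k0.
  have [s1 sfa] := hsigma Lh0.
  have k1 : sigma k h0 = 1 by apply: s1 => //; rewrite meetC; exact: meet_l.
  have [[n h] [Vt t0 /(_ (1%N, h0) erefl) rmin ->]] := PE _ k_nonimp.
  (* Rank 0 neglects [k], while rank 1 charges it since [h0 <= k]; so [sigma^~ h0] decides, and it
     gives [x] mass zero. *)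
  move: n Vt t0 rmin; rewrite /V /mu => -[|[|n]] /= Vt t0 rmin.
  + by move: t0; rewrite mpi // pk0 ltxx.
  + rewrite Vt (fa_probability_meet_sure hA sfa) //.
    rewrite -(fa_probability_meet_sure hA sfa Ax (ALA (LAL Lh0))).
      by rewrite meetC h0x (fa_probability_bot hA sfa) mul0r.
    exact: strategy_self.
  + by have := rmin; rewrite k1 ltr01 => /(_ erefl).
Qed.

(** The test for [k] implying [x] comes first because the value is then 1 even when [pi k = 0]. *)
Let value x k : R :=
  if (x `&` k == k)%O then 1 else if 0 < pi k then pi (x `&` k)%O / pi k else 0.

(** Here all extensions agree: by (C1) and (C2) when [k] implies [x], otherwise by (C3) conditioned
    on [\top]. *)
Lemma coherent_extension_value Q x k :
  coherent_extensions A AL L pi sigma Q -> AL x -> nonimpossible AL k ->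
  (x `&` k)%O = k \/ 0 < pi k -> Q x k = value x k.
Proof.
move=> [P [[P1 P2 P3] [Ppi Psigma] QP]] ALx ALk; rewrite QP // /value.
have [ALk' k0] := ALk; have Ak : nonimpossible A k by split=> //; exact: ALA.
have Ax := ALA ALx; have A_T : A \top%O by case: hA.
have AL_T : AL \top%O by case: hAL.
case: eqP => [xk _|xk [//|pk]].
  rewrite P1 // xk -[X in P X _]meet1x -P1 //.
  by have [_ -> _] := P2 _ Ak.
rewrite pk; have nT : nonimpossible A (\top%O : B).
  by split=> // T0; apply: k0; apply/eqP; rewrite -lex0 -T0 lex1.
have := P3 _ _ _ Ak.1 Ax nT; rewrite meetx1 !Ppi // => [/(_ Ak)|].
  by rewrite meetC => ->; rewrite mulrC mulKf // gt_eqF.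
by case: hAL => ? ? + _ _; apply.
Qed.

Lemma coherent_extension_ge Q x k :
  coherent_extensions A AL L pi sigma Q -> AL x -> nonimpossible AL k ->
  value x k <= Q x k.
Proof.
move=> PQ ALx ALk.
have [/coherent_extension_value->//|/not_orP[xk /negP pk]] :=
  pselect ((x `&` k)%O = k \/ 0 < pi k).
rewrite /value (negbTE pk); case: eqP => // _.
have [P [[_ P2 _] _ QP]] := PQ; rewrite QP //.
apply: fa_probability_ge0 (P2 k _) _ _; last exact: ALA.
by case: ALk => /ALA.
Qed.

(** In the undetermined case [k] is null and does not imply [x]; a cell below [k] and disjoint from
    [x] then yields an extension with value 0. *)
Lemma coherent_extension_attained x k : AL x -> nonimpossible AL k ->
  exists2 Q, coherent_extensions A AL L pi sigma Q & Q x k = value x k.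
Proof.
move=> ALx ALk; have [ALk' k0] := ALk.
have below y : AL y -> y <> \bot%O -> exists2 h, L h & (h <= y)%O.
  by move=> ALy; apply: set_partition_below => // h Lh; exact: ALdec.
have [val|/not_orP[xk /negP pk]] := pselect ((x `&` k)%O = k \/ 0 < pi k).
  (* Any cell serves: the value is forced, and only the existence of an extension is at stake. *)
  have [h Lh _] := below k ALk' k0.
  have [P [Pfcp Pext _]] := full_extension_avoiding Lh.
  have PP : coherent_extensions A AL L pi sigma P by exists P.
  by exists P => //; exact: coherent_extension_value.
have ALkx : AL (k `&` ~` x)%O.
  by case: hAL => _ _ ALI _ ALC; exact/ALI/ALC.
have [|h Lh hkx] := below _ ALkx.
  move=> /disjointP; rewrite complK => /meet_l; rewrite meetC; exact: xk.
have [P [Pfcp Pext P0]] := full_extension_avoiding Lh.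
exists P; first by exists P.
rewrite /value (negbTE pk) ifF; last exact/eqP.
apply: P0 => //.
- exact: ALA.
- by apply/eqP; rewrite -[_ == _]negbK; apply: contra pk; rewrite lt_neqAle eq_sym => ->;
    exact: fa_probability_ge0 hpi _ _.
- by apply: le_trans hkx _; exact: leIl.
- by apply/disjointP; apply: le_trans hkx _; exact: leIr.
Qed.

Lemma lower_envelope_value x k : AL x -> nonimpossible AL k ->
  lower_envelope (coherent_extensions A AL L pi sigma) x k = value x k.
Proof.
move=> ALx ALk; have [Q PQ Qv] := coherent_extension_attained ALx ALk.
have lb : lbound [set Q x k | Q in coherent_extensions A AL L pi sigma] (value x k).
  by move=> _ [Q' PQ' <-]; exact: coherent_extension_ge.
apply/eqP; rewrite eq_le; apply/andP; split.
  by rewrite -Qv; apply: ge_inf; [exists (value x k)|exists Q].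
by apply: lb_le_inf => //; exists (Q x k); exists Q.
Qed.

End CoherentExtension.

(** * Inclusion-exclusion sums *)

Section TotalMonotonicity.
Variables (n : nat) (a : 'I_n -> B).

Definition alternating_sum (phi : B -> R) : R :=
  \sum_(S : {set 'I_n} | S != finset.set0)
     (-1) ^+ #|S|.-1 * phi (\meet_(i in S) a i)%O.

(** Expand the product over [i] of [1 - [p i]], which equals one minus the indicator that some [p i]
    holds; the empty set contributes 1 and cancels. *)
Lemma alternating_sum_pred (p : pred 'I_n) (c : R) :
  \sum_(S : {set 'I_n} | S != finset.set0)
     (-1) ^+ #|S|.-1 * (c * [forall i in S, p i]%:R) = c * [exists i, p i]%:R.
Proof.
have prodE : \prod_(i < n) (- (p i)%:R + 1) = 1 - [exists i, p i]%:R :> R.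
  case: existsP => [[i pi]|np]; first by rewrite (bigD1 i) //= pi addNr mul0r subrr.
  rewrite subr0 big1 // => i _; case: (boolP (p i)) => [pi|_]; last by rewrite oppr0 add0r.
  by case: np; exists i.
have prodJ (J : {set 'I_n}) : \prod_i (if i \in J then - (p i)%:R else 1) =
    (-1) ^+ #|J| * [forall i in J, p i]%:R :> R.
  rewrite -big_mkcond prodrN; congr (_ * _).
  case: (boolP [forall _ in _, _]) => [/forall_inP pJ|/forall_inPn[i iJ /negbTE npi]].
    by rewrite big1 // => i /pJ->.
  by rewrite (bigD1 i) //= npi mul0r.
have := bigA_distr 1 (+%R : R -> R -> R) (fun i => - (p i)%:R) (fun _ : 'I_n => 1).
rewrite prodE (bigD1 finset.set0) //= prodJ cards0 mul1r.
have -> : [forall i in finset.set0, p i] by apply/forall_inP => i; rewrite finset.in_set0.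
move=> /addrI e; rewrite -[RHS]opprK -mulrN e mulr_sumr -sumrN.
apply: eq_big => [S|S S0]; first by [].
rewrite prodJ -[in RHS](@prednK #|S|) ?card_gt0 // exprS; ring.
Qed.

(** The sum is the indicator that a single [a i] contains [h]; the inequality may be strict, since
    [h] can lie below the join of the [a i] without lying below any of them. *)
Lemma alternating_sum_above h :
  alternating_sum (fun x => (h <= x)%O%:R) <= (h <= \join_(i < n) a i)%O%:R.
Proof.
suff -> : alternating_sum (fun x => (h <= x)%O%:R) = [exists i, (h <= a i)%O]%:R.
  rewrite ler_nat; case: existsP => // -[i hi].
  by rewrite (le_trans hi (joins_sup _ _)).
rewrite -[RHS]mul1r -alternating_sum_pred; apply: eq_bigr => S _.
rewrite mul1r; congr (_ * _%:R); apply: congr1.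
by apply/meetsP/forall_inP.
Qed.

(* Splitting [k] by the events one at a time reduces to the case where each of
   them contains [k] or is disjoint from it. *)
Lemma alternating_sum_fa A m k :
  boolean_subalgebra A -> fa_probability A m -> A k -> (forall i, A (a i)) ->
  alternating_sum (fun x => m (x `&` k)%O) = m ((\join_(i < n) a i) `&` k)%O.
Proof.
move=> hA hm + Aa.
have AI x y : A x -> A y -> A (x `&` y)%O by case: hA => ? ? + *; apply.
have AC x : A x -> A (~` x)%O by case: hA => ? ? ? ? +; apply.
have Ajoin : A (\join_(i < n) a i)%O.
  by elim/big_ind: _ => //; case: hA.
have Ameet (S : {set 'I_n}) : A (\meet_(i in S) a i)%O.
  by elim/big_ind: _ => //; case: hA.
(* Events of index at least [l] are already decided by [k']: vacuous at [l = n], all of them at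
   [l = 0]. *)
suff H l k' : A k' -> (forall i : 'I_n, (l <= i)%N -> decided k' (a i)) ->
    alternating_sum (fun x => m (x `&` k')%O) = m ((\join_(i < n) a i) `&` k')%O.
  by move=> Ak; apply: (H n) => // i; rewrite leqNgt ltn_ord.
elim: l k' => [|l IH] {}k Ak kdec.
  have -> : m (\join_(i < n) a i `&` k)%O = m k * [exists i, (k <= a i)%O]%:R.
    case: existsP => [[i ki]|nk].
      by rewrite mulr1 meet_r // (le_trans ki (joins_sup _ _)).
    rewrite mulr0 (_ : (_ `&` k)%O = \bot%O) ?(fa_probability_bot hA hm) //.
    apply/disjointP/joinsP => i _; apply/disjointP; rewrite meetC.
    by case: (kdec i) => // ki; case: nk; exists i.
  rewrite -alternating_sum_pred; apply: eq_bigr => S _; congr (_ * _).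
  case: (boolP [forall _ in _, _]) => [/forall_inP kS|/forall_inPn[i iS ki]].
    by rewrite mulr1 meet_r //; apply/meetsP.
  rewrite mulr0 (_ : (_ `&` k)%O = \bot%O) ?(fa_probability_bot hA hm) //.
  case: (kdec i) => // [ki'|kai]; first by rewrite ki' in ki.
  by rewrite meetC; apply/eqP; rewrite -lex0 -kai leI2 // meets_inf.
have [ln|nl] := ltnP l n; last first.
  by apply: IH => // i li; have := leq_trans nl li; rewrite leqNgt ltn_ord.
(* Cutting [k] by [b] gives two pieces that decide [b] as well as the events of larger index; both
   sides of the identity add over the pieces. *)
pose b := a (Ordinal ln).
have split_k x : A x -> m (x `&` k)%O = m (x `&` (k `&` b))%O + m (x `&` (k `&` ~` b))%O.
  by move=> Ax; rewrite (fa_probability_split hA hm (AI _ _ Ax Ak) (Aa (Ordinal ln))) !meetA.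
have dec (i : 'I_n) c : (l <= i)%N -> decided c b -> decided (k `&` c)%O (a i).
  rewrite leq_eqVlt => /orP[/eqP li|li] cb; apply: decided_meet; last by left; exact: kdec.
  by right; rewrite (_ : a i = b) //; congr a; exact/val_inj/esym.
rewrite split_k // -!IH.
- rewrite /alternating_sum -big_split; apply: eq_bigr => S _ /=.
  by rewrite split_k // mulrDr.
- exact/AI/AC/Aa.
- by move=> i li; apply: dec => //; right; rewrite meetC meetxC.
- exact/AI/Aa.
- by move=> i li; apply: dec => //; left.
Qed.

End TotalMonotonicity.
End Probability.

(** * Minimum, total monotonicity and formula for the lower envelope *)

Theorem corollary1 (R : realType) (d : Order.disp_t)
    (B : ctbDistrLatticeType d) (hB : complete_events B)
    (I J : Type) (H : I -> B) (E : J -> B)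
    (hH : partition_of_top H) (hE : partition_of_top E)
    (AL AE A : set B)
    (hAL : boolean_subalgebra AL) (hAE : boolean_subalgebra AE)
    (hA : boolean_subalgebra A)
    (hAL1 : subset (generated (range H)) AL)
    (hAL2 : subset AL (complete_generated (range H)))
    (hAE1 : subset (generated (range E)) AE)
    (hAE2 : subset AE (complete_generated (range E)))
    (hA1 : subset (generated (setU AL AE)) A)
    (hA2 : subset A (complete_generated (setU AL AE)))
    (sigma : B -> B -> R) (hsigma : strategy A (range H) sigma)
    (hcont : forall F : B, A F -> continuous_wrt AL (range H) (sigma F))
    (pi : B -> R) (hpi : fa_probability AL pi) :
  let Pp := coherent_extensions A AL (range H) pi sigma in
  let lpi := lower_envelope Pp in
  (* the lower envelope is a pointwise minimum *)
  (forall F K : B, AL F -> nonimpossible AL K ->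
     (exists2 Q, Pp Q & Q F K = lpi F K) /\
     (forall Q, Pp Q -> lpi F K <= Q F K)) /\
  (forall K : B, nonimpossible AL K ->
     totally_monotone AL (fun F => lpi F K)) /\
  (forall F K : B, AL F -> nonimpossible AL K ->
     ((F `&` K)%O = K -> lpi F K = 1) /\
     ((F `&` K)%O <> K ->
        lpi F K = if 0 < pi K then pi (F `&` K)%O / pi K else 0)).
Proof.
move=> Pp lpi.
have hL := partition_of_top_range hH; have hD := partition_of_top_range hE.
have LAL : range H `<=` AL by apply: subset_trans hAL1; exact: sub_gen_smallest.
have ALA : AL `<=` A.
  by apply: subset_trans hA1; apply: sub_smallest; exact: subsetUl.
have ALdec h x : range H h -> AL x -> decided h x.
  move=> Lh ALx; apply: (complete_generated_decided hL _ Lh (hAL2 _ ALx)) => k y Lk Ly.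
  exact: set_partition_decided hL Lk Ly.
have AEdec h x : range E h -> AE x -> decided h x.
  move=> Lh ALx; apply: (complete_generated_decided hD _ Lh (hAE2 _ ALx)) => k y Lk Ly.
  exact: set_partition_decided hD Lk Ly.
have hM := set_partition_meet hL hD.
(* In a nonimpossible [H i & E j], the first factor decides [AL] and the second decides [AE]. *)
have Adec h x : set_meet (range H) (range E) h -> A x -> decided h x.
  move=> Mh Ax; apply: (complete_generated_decided hM _ Mh (hA2 _ Ax)).
  move=> _ y [_ [i [j [Hi Ej ->]]]] [ALy|AEy]; apply: decided_meet; [left|right].
    exact: ALdec.
  exact: AEdec.
have lpiE F K : AL F -> nonimpossible AL K -> lpi F K =
    if (F `&` K == K)%O then 1 else if 0 < pi K then pi (F `&` K)%O / pi K else 0.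
  exact: (lower_envelope_value hA hAL LAL ALA hL ALdec hM Adec hsigma hpi).
split; [|split].
- move=> F K ALF ALK; split.
    rewrite lpiE //.
    exact: (coherent_extension_attained hA hAL LAL ALA hL ALdec hM Adec hsigma hpi).
  move=> Q PQ; rewrite lpiE //; exact: (coherent_extension_ge hA hAL ALA PQ).
- move=> K ALK; have [ALK' K0] := ALK.
  have AL0 : AL \bot%O by case: hAL.
  have ALT : AL \top%O by case: hAL.
  have AL_joins n (a : 'I_n -> B) : (forall i, AL (a i)) -> AL (\join_(i < n) a i)%O.
    by move=> ALa; elim/big_ind: _ => //; case: hAL.
  have AL_meets n (a : 'I_n -> B) (S : {set 'I_n}) :
      (forall i, AL (a i)) -> AL (\meet_(i in S) a i)%O.
    by move=> ALa; elim/big_ind: _ => //; case: hAL.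
  (* For [pi K > 0] the envelope is a conditional probability, and inclusion-exclusion is an
     equality. *)
  have [piK|piK] := boolP (0 < pi K).
    have lpi_cond F : AL F -> lpi F K = pi (F `&` K)%O / pi K.
      move=> ALF; rewrite lpiE // piK; case: eqP => // ->.
      by rewrite divff // gt_eqF.
    have cfa := fa_probability_conditional hAL hpi ALK' piK.
    split; first split.
    + by move=> x ALx; rewrite lpi_cond //; case: cfa => + _ _; apply.
    + by rewrite lpi_cond // (fa_probability_bot hAL cfa).
    + by rewrite lpi_cond //; case: cfa.
    + by move=> x y ALx ALy xy; rewrite !lpi_cond // (fa_probability_mono hAL cfa).
    + move=> n a _ ALa; rewrite lpi_cond; last exact: AL_joins.
      rewrite -(alternating_sum_fa hAL hpi) // /alternating_sum mulr_suml.
      apply: ler_sum => S _; rewrite lpi_cond ?mulrA //; exact: AL_meets.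
  (* For null [K] the envelope is the unanimity game of [K]. *)
  have lpi_above F : AL F -> lpi F K = (K <= F)%O%:R.
    by move=> ALF; rewrite lpiE // (negbTE piK) leEmeet meetC; case: eqP.
  split; first split.
  + by move=> x ALx; rewrite lpi_above //; case: (K <= x)%O; rewrite ?lexx ler01.
  + by rewrite lpi_above // lex0; case: eqP.
  + by rewrite lpi_above // lex1.
  + move=> x y ALx ALy xy; rewrite !lpi_above // ler_nat.
    by case Kx : (K <= x)%O; rewrite // (le_trans Kx xy).
  + move=> n a _ ALa; rewrite lpi_above; last exact: AL_joins.
    apply: le_trans (alternating_sum_above a K).
    apply: ler_sum => S _; rewrite lpi_above //; exact: AL_meets.
- move=> F K ALF ALK; rewrite lpiE //; by case: eqP.
Qed.
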